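(* Let $k\ge 2$, $\sigma\in\{+,-\}^k$, $n\ge2$, $\pi\in\mathcal{S}_n$ and $w\in\mathcal{W}_k$. Then $\operatorname{Pat}(w,\Sigma_\sigma,n)=\pi$ if and only if there exists a valid $\sigma$-segmentation of $\hat\pi^\star$ with associated prefix $\zeta=w_{[1,n-1]}$ such that the following condition (depending on $\pi_n$) is satisfied: (a) if $\pi_n\notin\{1,n\}$, then $q^\infty<_\sigma w_{[n,\infty)}<_\sigma p^\infty$; (b) if $\pi_n=1$, then $\omega_\sigma\le_\sigma w_{[n,\infty)}<_\sigma p^\infty$; (c) if $\pi_n=n$, then $q^\infty<_\sigma w_{[n,\infty)}\le_\sigma\Omega_\sigma$. Here $p,q$ are the words associated with $\zeta$.
   Context: **Signed shift.** Write $\sigma=\sigma_0\cdots\sigma_{k-1}$, $T_\sigma^-=\{t:\sigma_t=-\}$. Let $\mathcal{W}_k$ be the set of infinite words $w=w_1w_2\cdots$ on $\{0,1,\dots,k-1\}$; $w_{[i,j]}=w_i\cdots w_j$, $w_{[i,\infty)}=w_iw_{i+1}\cdots$; $d^\infty$ is the infinite periodic word $ddd\cdots$. The linear order $<_\sigma$ on $\mathcal{W}_k$: for $v\neq w$ let $j$ be the first position where they differ; if the number of $i<j$ with $v_i\in T_\sigma^-$ is even, then $v<_\sigma w$ iff $v_j<w_j$; if odd, then $v<_\sigma w$ iff $v_j>w_j$. The signed shift is $\Sigma_\sigma(w_1w_2w_3\cdots)=w_2w_3\cdots$ on $(\mathcal{W}_k,<_\sigma)$. $\Omega_\sigma$ and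 $\omega_\sigma$ denote the largest and smallest words in $\mathcal{W}_k$ with respect to $<_\sigma$. **Patterns.** $\operatorname{Pat}(w,\Sigma_\sigma,n)\in\mathcal{S}_n$ is the permutation whose entries are in the same relative order (under $<_\sigma$) as $w_{[1,\infty)},w_{[2,\infty)},\dots,w_{[n,\infty)}$; it is undefined if these words are not distinct. **Marked cycle.** For $\pi\in\mathcal{S}_n$, $\hat\pi^\star=\hat\pi^\star_1\cdots\hat\pi^\star_n$ is defined by $\hat\pi^\star_{\pi_i}=\pi_{i+1}$ for $1\le i\le n-1$ and $\hat\pi^\star_{\pi_n}=\star$ (a symbol). A block of consecutive entries of $\hat\pi^\star$ is increasing (decreasing) if it is so after deleting $\star$, if present. **$\sigma$-segmentation.** A $\sigma$-segmentation of $\hat\pi^\star$ is a sequence $E=(e_0,\dots,e_k)$ of integers with $0=e_0\le e_1\le\dots\le e_k=n$ such that (a) for all $0\le t\le k-1$, $\hat\pi^\star_{e_t+1}\cdots\hat\pi^\star_{e_{t+1}}$ is increasing if $\sigma_t=+$ and decreasing if $\sigma_t=-$; (b) if $\sigma_0=+$ and $\pi_{n-1}\pi_n=21$, then $e_1=0$; (c) if $\sigma_{k-1}=+$ and $\pi_{n-1}\pi_n=(n-1)n$, then $e_{k-1}=n-1$; (d) if $\sigma_0=\sigma_{k-1}=-$ and $\pi_{n-2}\pi_{n-1}\pi_n=(n-1)\,1\,n$, then $e_1=0$ or $e_{k-1}=n-1$; (e) if $\sigma_0=\sigma_{k-1}=-$ and $\pi_{n-2}\pi_{n-1}\pi_n=2\,n\,1$,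 then $e_1=0$ or $e_{k-1}=n$; (f) $e_t\ne\pi_n$ for all $1\le t\le k-1$. Its associated prefix is $\zeta=z_1\cdots z_{n-1}$, with $z_i=j$ whenever $e_j<\pi_i\le e_{j+1}$. **Validity.** If $\pi_n\ne n$, let $x$ be the index with $\pi_x=\pi_n+1$ and $p=z_{[x,n-1]}$. If $\pi_n\neq1$, let $y$ be the index with $\pi_y=\pi_n-1$ and $q=z_{[y,n-1]}$. The segmentation is invalid if $\pi_n\notin\{1,n\}$ and ($p=q^2$ or $q=p^2$), where $d^2$ is $d$ concatenated with itself; otherwise it is valid. *)

(* Defs.v *)
From Stdlib Require Import Classical.
From mathcomp Require Import all_boot.
From mathcomp Require Import fingroup perm.

Set Implicit Arguments.
Unset Strict Implicit.
Unset Printing Implicit Defensive.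

(* Throughout, positions in words, one-line entries of permutations and indices
   of segmentations are written 1-based, as in w_1 w_2 w_3 ... and
   pi_1 ... pi_n.  Only the underlying representations are 0-based: an infinite
   word is a function on nat whose value at 0 is w_1, and a permutation is an
   element of 'S_n. *)

(** * Infinite words and the signed order *)

Variant sign := Plus | Minus.

Definition word (k : nat) := nat -> 'I_k.

(* sigma_t; the default Plus is only returned for t >= k. *)
Definition sgn k (sigma : k.-tuple sign) (t : nat) : sign := nth Plus sigma t.

Definition Tminus k (sigma : k.-tuple sign) : pred 'I_k :=
  fun t => if sgn sigma t is Minus then true else false.

Definition flips k (sigma : k.-tuple sign) (v : word k) (j : nat) : nat :=
  \sum_(i < j | v i \in Tminus sigma) 1.

(* Words are compared with pointwise equality, so that no extensionality
   principle is involved. *)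
Definition lt_sigma k (sigma : k.-tuple sign) (v w : word k) : Prop :=
  exists j : nat, (forall i, i < j -> v i = w i) /\
    (if odd (flips sigma v j) then w j < v j else v j < w j).

Definition le_sigma k (sigma : k.-tuple sign) (v w : word k) : Prop :=
  v =1 w \/ lt_sigma sigma v w.

Definition signed_shift k (w : word k) : word k := fun m => w m.+1.

(* w_{[i,oo)}, for i >= 1 *)
Definition tail k (w : word k) (i : nat) : word k :=
  iter i.-1 (@signed_shift k) w.

(* w_{[i,j]}, for i >= 1 *)
Definition factor k (w : word k) (i j : nat) : seq 'I_k :=
  [seq w m | m <- iota i.-1 (j - i.-1)].

Definition letter0 k (hk : 2 <= k) : 'I_k := Ordinal (ltnW hk).

(* d^oo; the default letter c0 is only used for the empty word d. *)
Definition periodic k (c0 : 'I_k) (d : seq 'I_k) : word k :=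
  fun m => nth c0 d (m %% size d).

(** * Extremal words *)

Definition is_smallest k (sigma : k.-tuple sign) (v : word k) : Prop :=
  forall u : word k, le_sigma sigma v u.

Definition is_largest k (sigma : k.-tuple sign) (v : word k) : Prop :=
  forall u : word k, le_sigma sigma u v.

Section ExtremalWords.
Variables (k : nat) (hk : 2 <= k) (sigma : k.-tuple sign).

Let ext_letter (b : bool) : 'I_k :=
  if b then rev_ord (letter0 hk) else letter0 hk.

(* Greedy construction: the next letter is k-1 if the current state is true
   and 0 otherwise; reading a letter of Tminus flips the state. *)
Let ext_state (b : bool) (i : nat) : bool :=
  iter i (fun c => c (+) (ext_letter c \in Tminus sigma)) b.

Let ext_word (b : bool) : word k := fun i => ext_letter (ext_state b i).

Let ext_stateE b j : ext_state b j = b (+) odd (flips sigma (ext_word b) j).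
Proof.
elim: j => [|j IHj]; first by rewrite /flips big_ord0 addbF.
rewrite /flips big_mkcond big_ord_recr -big_mkcond /= -/(flips _ _ j) oddD.
rewrite addbA -IHj /= -/(ext_state b j) /ext_word.
by case: (_ \in _).
Qed.

Let flips_eq (v w : word k) j :
  (forall i, i < j -> v i = w i) -> flips sigma v j = flips sigma w j.
Proof. by move=> eq_vw; apply: eq_bigl => i; rewrite eq_vw. Qed.

Let first_diff (v w : word k) : v =1 w \/
  exists j, (forall i, i < j -> v i = w i) /\ v j != w j.
Proof.
case: (classic (exists j, v j != w j)) => [ex_j|nex]; [right | left].
  exists (ex_minn ex_j); case: ex_minnP => j neq_j min_j; split=> // i lt_ij.
  by apply/eqP; apply: contraLR lt_ij => /min_j; rewrite -leqNgt.
by move=> j; apply/eqP; apply: contraT => neq_j; case: nex; exists j.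
Qed.

Let letter0_lt (c : 'I_k) : letter0 hk != c -> letter0 hk < c.
Proof. by rewrite -val_eqE /= lt0n eq_sym. Qed.

Let letter_max_lt (c : 'I_k) :
  rev_ord (letter0 hk) != c -> c < rev_ord (letter0 hk).
Proof.
rewrite -val_eqE /= => neq_c; rewrite ltn_neqAle eq_sym neq_c subn1.
by rewrite -ltnS (ltn_predK hk) ltn_ord.
Qed.

Lemma smallest_word_exists : {v : word k | is_smallest sigma v}.
Proof.
exists (ext_word false) => u; case: (first_diff (ext_word false) u); first by left.
case=> j [eq_lt neq_j]; right; exists j; split=> //; move: neq_j.
by rewrite /ext_word ext_stateE addFb; case: odd; [apply: letter_max_lt | apply: letter0_lt].
Qed.

Lemma largest_word_exists : {v : word k | is_largest sigma v}.
Proof.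
exists (ext_word true) => u; case: (first_diff (ext_word true) u) => [e|].
  by left=> i; rewrite e.
case=> j [eq_lt neq_j]; right; exists j; split=> [i /eq_lt //|]; move: neq_j.
rewrite -(flips_eq eq_lt) /ext_word ext_stateE addTb.
by case: odd; [apply: letter0_lt | apply: letter_max_lt].
Qed.

(* Up to pointwise equality these words are determined by the properties
   proj2_sig smallest_word_exists and proj2_sig largest_word_exists. *)
Definition omega_word : word k := proj1_sig smallest_word_exists.
Definition Omega_word : word k := proj1_sig largest_word_exists.

End ExtremalWords.

(** * Permutations in one-line notation, patterns *)

Definition one_line n (pi : 'S_n) : seq nat := [seq (pi i).+1 | i <- enum 'I_n].

(* pi_i, for 1 <= i <= n (and 0 otherwise) *)
Definition entry n (pi : 'S_n) (i : nat) : nat := nth 0 (0 :: one_line pi) i.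

(* the index i with pi_i = v, for 1 <= v <= n *)
Definition position n (pi : 'S_n) (v : nat) : nat := (index v (one_line pi)).+1.

(* Pat(w, Sigma_sigma, n) is defined and equal to pi. *)
Definition has_pattern k (sigma : k.-tuple sign) (w : word k) n (pi : 'S_n) : Prop :=
  (forall i j, 1 <= i -> i < j -> j <= n -> ~ (tail w i =1 tail w j)) /\
  (forall i j, 1 <= i <= n -> 1 <= j <= n ->
     (entry pi i < entry pi j <-> lt_sigma sigma (tail w i) (tail w j))).

(* The entry at index v of the marked cycle of pi, with None for the star. *)
Definition marked n (pi : 'S_n) (v : nat) : option nat :=
  let i := position pi v in
  if i < n then Some (entry pi i.+1) else None.

Lemma marked_entry n (pi : 'S_n) (i : nat) : 1 <= i -> i < n ->
  marked pi (entry pi i) = Some (entry pi i.+1).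
Proof.
case: i => // i _ lt_in; rewrite /marked /position {1 2}/entry /=.
have inj : injective (fun i : 'I_n => (pi i).+1).
  by move=> x y [] /val_inj /perm_inj.
rewrite index_uniq ?lt_in //; last by rewrite map_inj_uniq ?enum_uniq.
by rewrite size_map size_enum_ord ltnW.
Qed.

Lemma marked_last n (pi : 'S_n) : 1 <= n -> marked pi (entry pi n) = None.
Proof.
case: n pi => // n pi _; rewrite /marked /position {1}/entry /=.
have inj : injective (fun i : 'I_n.+1 => (pi i).+1).
  by move=> x y [] /val_inj /perm_inj.
rewrite index_uniq ?ltnn //; last by rewrite map_inj_uniq ?enum_uniq.
by rewrite size_map size_enum_ord.
Qed.

(** * Segmentations *)

(* e_t, for 0 <= t <= k *)
Definition cut k (E : k.+1.-tuple nat) (t : nat) : nat := nth 0 E t.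

(* The entries a+1, ..., b of the marked cycle, with the star deleted. *)
Definition block n (pi : 'S_n) (a b : nat) : seq nat :=
  pmap (marked pi) (iota a.+1 (b - a)).

(* In seg_b to seg_e, [suffix s (one_line pi)] says that pi_1 ... pi_n ends with
   the entries of s; for n = 2 it is false when s has three entries. *)
Record is_segmentation k (sigma : k.-tuple sign) n (pi : 'S_n)
    (E : k.+1.-tuple nat) : Prop := IsSegmentation {
  seg_first : cut E 0 = 0;
  seg_mono : forall t, t < k -> cut E t <= cut E t.+1;
  seg_last : cut E k = n;
  seg_a : forall t, t < k ->
    let s := block pi (cut E t) (cut E t.+1) in
    match sgn sigma t with Plus => sorted ltn s | Minus => sorted gtn s end;
  seg_b : sgn sigma 0 = Plus -> suffix [:: 2; 1] (one_line pi) -> cut E 1 = 0;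
  seg_c : sgn sigma k.-1 = Plus -> suffix [:: n.-1; n] (one_line pi) ->
    cut E k.-1 = n.-1;
  seg_d : sgn sigma 0 = Minus -> sgn sigma k.-1 = Minus ->
    suffix [:: n.-1; 1; n] (one_line pi) -> cut E 1 = 0 \/ cut E k.-1 = n.-1;
  seg_e : sgn sigma 0 = Minus -> sgn sigma k.-1 = Minus ->
    suffix [:: 2; n; 1] (one_line pi) -> cut E 1 = 0 \/ cut E k.-1 = n;
  seg_f : forall t, 1 <= t <= k.-1 -> cut E t <> entry pi n
}.

Definition is_prefix_of k n (pi : 'S_n) (E : k.+1.-tuple nat)
    (zeta : seq 'I_k) : Prop :=
  size zeta = n.-1 /\
  forall (i : nat) (j : 'I_k), 1 <= i <= n.-1 ->
    cut E j < entry pi i <= cut E j.+1 -> onth zeta i.-1 = Some j.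

(* The word z_{[i,n-1]}, where zeta = z_1 ... z_{n-1} *)
Definition prefix_from k (zeta : seq 'I_k) (i : nat) : seq 'I_k := drop i.-1 zeta.

(* p is meaningful only if pi_n <> n, and q only if pi_n <> 1. *)
Definition word_p k n (pi : 'S_n) (zeta : seq 'I_k) : seq 'I_k :=
  prefix_from zeta (position pi (entry pi n).+1).

Definition word_q k n (pi : 'S_n) (zeta : seq 'I_k) : seq 'I_k :=
  prefix_from zeta (position pi (entry pi n).-1).

Definition invalid k n (pi : 'S_n) (zeta : seq 'I_k) : Prop :=
  let p := word_p pi zeta in
  let q := word_q pi zeta in
  [/\ entry pi n <> 1, entry pi n <> n & p = q ++ q \/ q = p ++ p].

(* E is a valid sigma-segmentation with associated prefix zeta. *)
Definition valid_segmentation k (sigma : k.-tuple sign) n (pi : 'S_n)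
    (E : k.+1.-tuple nat) (zeta : seq 'I_k) : Prop :=
  [/\ is_segmentation sigma pi E, is_prefix_of pi E zeta & ~ invalid pi zeta].

(* Main.v *)
From Stdlib Require Import Classical.
Require Import Defs.
From mathcomp Require Import all_boot.
From mathcomp Require Import fingroup perm.
From mathcomp Require Import zify.

Set Implicit Arguments.
Unset Strict Implicit.
Unset Printing Implicit Defensive.

(** Write W_i for the tail of w that starts at position i, and let x and y be
    the positions of the entries pi_n + 1 and pi_n - 1.

    The link between the two sides is [lt_periodic]: for a nonempty finite word
    d, a word u satisfies u < d^oo exactly when u < d u, and u > d^oo exactly
    when u > d u, whatever the signs of the letters of d.  As zeta is a prefix
    of w, we have W_x = p W_n and W_y = q W_n; so the inequalities between W_n
    and the words p^oo and q^oo say exactly that W_y < W_n < W_x, that is, that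
    W_n lies between its two neighbours in the order prescribed by pi
    ([bounds_periodic]).

    From a segmentation to the pattern: the blocks being monotone, pi_i < pi_j
    with i, j < n forces w_i <= w_j, and in case of equality pi_{i+1} and
    pi_{j+1} compare as the sign of that letter requires
    ([segmentation_compatible]).  Suppose that some pair is inverted, meaning
    that pi_i < pi_j but W_j < W_i, and let d be the depth of the first
    difference between these tails.  When i, j < n, deleting the common first
    letter gives an inverted pair of depth d - 1.  When i = n, we have
    W_j < W_n < W_x, and the pair (x, j) is inverted at depth at most d because
    the words W_j and W_x can share no more than what both share with W_n;
    similarly with y when j = n.  So there is no inverted pair
    ([no_inversion]).  Two equal tails would, after a shift, give a tail equal
    to W_n, and again an inverted pair with x or y ([compatible_pattern]).

    From the pattern to a segmentation: let e_t be the largest pi_i with i < n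
    and w_i < t, and let e_k = n.  The tails W_i with w_i < t are the smallest
    ones, so this cuts the marked cycle by letters, and e_t differs from pi_n by
    construction.  Each of the four conditions on the last entries of pi could
    only fail if W_n were below d W_n, or above it, with d one of the words
    0, k-1, 0(k-1), (k-1)0 and with signs that make d^oo the smallest,
    respectively the largest, word; [lt_periodic] excludes this.  Finally the
    segmentation is valid because p = qq or q = pp would give p^oo = q^oo,
    whereas q^oo < W_n < p^oo. *)

(** * The signed order and the first difference *)

Lemma in_Tminus k (sigma : k.-tuple sign) (c : 'I_k) :
  (c \in Tminus sigma) = (if sgn sigma c is Minus then true else false).
Proof. by []. Qed.

(** Recording the position d of the first difference makes it available as an
    induction measure. *)
Definition lt_at k (sigma : k.-tuple sign) (d : nat) (u v : word k) : Prop :=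
  (forall i, i < d -> u i = v i) /\
  (if odd (flips sigma u d) then v d < u d else u d < v d).

Lemma eq_flips k (sigma : k.-tuple sign) (u v : word k) d :
  (forall i, i < d -> u i = v i) -> flips sigma u d = flips sigma v d.
Proof. by move=> eq_uv; apply: eq_bigl => i; rewrite eq_uv. Qed.

Lemma flips_recl k (sigma : k.-tuple sign) (u : word k) d :
  flips sigma u d.+1 =
  (u 0 \in Tminus sigma) + flips sigma (signed_shift u) d.
Proof.
rewrite /flips big_mkcond big_ord_recl [in RHS]big_mkcond /=.
by case: (_ \in _).
Qed.

Lemma lt_at_irr k (sigma : k.-tuple sign) d (u : word k) : ~ lt_at sigma d u u.
Proof. by case=> _; rewrite ltnn; case: odd. Qed.

(** The first difference between u and w is at the first of the two positions
    where v differs from one of them. *)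
Lemma lt_at_trans k (sigma : k.-tuple sign) d e (u v w : word k) :
  lt_at sigma d u v -> lt_at sigma e v w -> lt_at sigma (minn d e) u w.
Proof.
move=> [eq_uv lt_uv] [eq_vw lt_vw]; split=> [i|].
  by rewrite leq_min => /andP[/eq_uv-> /eq_vw].
case: (ltngtP d e) => [lt_de|lt_ed|eq_de].
- by rewrite -(eq_vw _ lt_de).
- rewrite (@eq_flips _ sigma u v) ?(eq_uv _ lt_ed) //.
  by move=> i /ltn_trans/(_ lt_ed)/eq_uv.
- subst e; move: lt_uv lt_vw; rewrite (eq_flips sigma eq_uv).
  by case: odd => lt1 lt2; [apply: ltn_trans lt2 lt1 | apply: ltn_trans lt1 lt2].
Qed.

Lemma lt_sigma_asym k (sigma : k.-tuple sign) (u v : word k) :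
  lt_sigma sigma u v -> ~ lt_sigma sigma v u.
Proof. by move=> [d uv] [e vu]; apply: lt_at_irr (lt_at_trans uv vu). Qed.

Lemma lt_at_eqr k (sigma : k.-tuple sign) d (u v v' : word k) :
  (forall i, i <= d -> v i = v' i) -> lt_at sigma d u v -> lt_at sigma d u v'.
Proof.
move=> eq_v [eq_uv lt_uv]; split=> [i lt_id|]; last by rewrite -eq_v.
by rewrite eq_uv // eq_v // ltnW.
Qed.

Lemma lt_at_eql k (sigma : k.-tuple sign) d (u u' v : word k) :
  (forall i, i <= d -> u i = u' i) -> lt_at sigma d u v -> lt_at sigma d u' v.
Proof.
move=> eq_u [eq_uv lt_uv]; split=> [i lt_id|].
  by rewrite -eq_u ?eq_uv // ltnW.
by rewrite -(@eq_flips _ sigma u u') ?(eq_u d) // -?eq_u // => i /ltnW/eq_u.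
Qed.

Lemma lt_sigma_eqr k (sigma : k.-tuple sign) (u v v' : word k) :
  v =1 v' -> lt_sigma sigma u v -> lt_sigma sigma u v'.
Proof. by move=> eq_v [d uv]; exists d; apply: lt_at_eqr uv. Qed.

Lemma lt_sigma_eql k (sigma : k.-tuple sign) (u u' v : word k) :
  u =1 u' -> lt_sigma sigma u v -> lt_sigma sigma u' v.
Proof. by move=> eq_u [d uv]; exists d; apply: lt_at_eql uv. Qed.

Lemma lt_sigma_total k (sigma : k.-tuple sign) (u v : word k) :
  [\/ u =1 v, lt_sigma sigma u v | lt_sigma sigma v u].
Proof.
case: (classic (exists j, u j != v j)) => [ex_j|nex]; last first.
  constructor 1=> j; apply/eqP; apply: contraT => neq_j.
  by case: nex; exists j.
case: (ex_minnP ex_j) => d neq_d min_d.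
have eq_uv i : i < d -> u i = v i.
  by move=> lt_id; apply/eqP; apply: contraLR lt_id => /min_d; rewrite -leqNgt.
have eq_vu i : i < d -> v i = u i by move=> /eq_uv.
move: neq_d; rewrite -val_eqE /= neq_ltn.
case odd_d: (odd (flips sigma u d)); case/orP=> lt_d.
- by constructor 3; exists d; rewrite -(eq_flips sigma eq_uv) odd_d.
- by constructor 2; exists d; rewrite odd_d.
- by constructor 2; exists d; rewrite odd_d.
- by constructor 3; exists d; rewrite -(eq_flips sigma eq_uv) odd_d.
Qed.

Lemma lt_at_head k (sigma : k.-tuple sign) d (u v : word k) :
  lt_at sigma d u v -> u 0 <= v 0.
Proof.
case: d => [|d] [eq_uv]; last by rewrite (eq_uv 0).
by rewrite /flips big_ord0 /= => /ltnW.
Qed.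

(** A common first letter of negative sign reverses the comparison of the
    remaining words. *)
Lemma lt_at_shift k (sigma : k.-tuple sign) d (u v : word k) :
    u 0 = v 0 -> lt_at sigma d u v ->
  0 < d /\
  if u 0 \in Tminus sigma
  then lt_at sigma d.-1 (signed_shift v) (signed_shift u)
  else lt_at sigma d.-1 (signed_shift u) (signed_shift v).
Proof.
move=> eq0; case: d => [|d] [eq_uv].
  by rewrite /flips big_ord0 eq0 ltnn.
rewrite flips_recl oddD oddb => lt_uv; split=> //=.
have eq_s i : i < d -> signed_shift u i = signed_shift v i.
  by move=> lt_id; apply: eq_uv.
move: lt_uv; case: (_ \in _) => /= lt_uv; last by split.
split=> [i /eq_s //|]; rewrite -(eq_flips sigma eq_s).
by move: lt_uv; case: odd.
Qed.

Lemma lt_sigma_shift k (sigma : k.-tuple sign) (u v : word k) :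
    u 0 = v 0 -> lt_sigma sigma u v ->
  if u 0 \in Tminus sigma
  then lt_sigma sigma (signed_shift v) (signed_shift u)
  else lt_sigma sigma (signed_shift u) (signed_shift v).
Proof.
move=> eq0 [d /(lt_at_shift eq0)[_]].
by case: (_ \in _) => lt_s; exists d.-1.
Qed.

(** * Comparison with periodic words *)

Lemma periodic_addl k (c0 : 'I_k) d m :
  periodic c0 d (size d + m) = periodic c0 d m.
Proof. by rewrite /periodic modnDl. Qed.

Lemma periodic_lt k (c0 : 'I_k) d m :
  m < size d -> periodic c0 d m = nth c0 d m.
Proof. by move=> lt_m; rewrite /periodic modn_small. Qed.

Lemma periodic_double k (c0 : 'I_k) d : periodic c0 (d ++ d) =1 periodic c0 d.
Proof.
move=> m; rewrite /periodic size_cat addnn -muln2.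
case: (posnP (size d)) => [/size0nil-> //|d_gt0].
rewrite nth_cat -[in RHS](@modn_dvdm (size d * 2)) ?dvdn_mulr //.
have: m %% (size d * 2) < size d * 2 by rewrite ltn_pmod // muln_gt0 d_gt0.
move: (m %% _) => r lt_r2; case: ltnP => [lt|le].
  by rewrite (modn_small lt).
by rewrite -[in RHS](subnKC le) modnDl modn_small //; lia.
Qed.

(** Here v is the word d u.  If u agrees with d^oo before position j, then d u
    agrees with d^oo up to j included; and if u agrees with d u before j, then by
    induction u agrees with d^oo there.  So d u and d^oo have the same first
    difference with u, and the same letter at that place. *)
Lemma lt_periodic k (sigma : k.-tuple sign) (c0 : 'I_k) d (u v : word k) :
    0 < size d -> (forall m, m < size d -> v m = nth c0 d m) ->
    (forall m, v (size d + m) = u m) ->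
  (lt_sigma sigma u v <-> lt_sigma sigma u (periodic c0 d)) /\
  (lt_sigma sigma v u <-> lt_sigma sigma (periodic c0 d) u).
Proof.
move=> d_gt0 v_lo v_hi; set per := periodic c0 d.
have agree_per j :
    (forall i, i < j -> u i = per i) -> forall i, i <= j -> v i = per i.
  move=> eq_u i le_ij; case: (ltnP i (size d)) => [lt_i|le_i].
    by rewrite v_lo // /per periodic_lt.
  rewrite -(subnKC le_i) v_hi /per periodic_addl eq_u //.
  by rewrite (leq_trans _ le_ij) // ltn_subrL d_gt0 (leq_trans d_gt0).
(* The induction turns agreement of u with v into agreement with d^oo. *)
have agree_cat j :
    (forall i, i < j -> u i = v i) -> forall i, i <= j -> v i = per i.
  elim: j => [|j IHj] eq_u; apply: agree_per => // i lt_ij.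
  by rewrite eq_u // IHj // => l lt_lj; rewrite eq_u // ltnW.
split; split=> -[j cmp]; exists j; move: (cmp) => [eq_j _].
- by apply: lt_at_eqr cmp; apply: agree_cat.
- by apply: lt_at_eqr cmp => i le_ij; rewrite (agree_per j).
- by apply: lt_at_eql cmp; apply: agree_cat => i /eq_j.
- by apply: lt_at_eql cmp => i le_ij; rewrite (agree_per j) // => l /eq_j.
Qed.

(** * Tails and factors *)

Lemma tailE k (w : word k) i m : tail w i m = w (i.-1 + m).
Proof.
rewrite /tail; elim: (i.-1) m => [|j IHj] m //=.
by rewrite /signed_shift IHj addnS.
Qed.

Lemma tailS k (w : word k) i : 0 < i -> tail w i.+1 = signed_shift (tail w i).
Proof. by case: i. Qed.

Lemma tail0 k (w : word k) i : tail w i 0 = w i.-1.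
Proof. by rewrite tailE addn0. Qed.

Lemma size_factor k (w : word k) n : size (factor w 1 n.-1) = n.-1.
Proof. by rewrite size_map size_iota subn0. Qed.

Lemma nth_factor k (w : word k) (c0 : 'I_k) n m :
  m < n.-1 -> nth c0 (factor w 1 n.-1) m = w m.
Proof.
by move=> lt_m; rewrite (nth_map 0) ?size_iota ?subn0 // nth_iota.
Qed.

Lemma lt_tail_periodic k (sigma : k.-tuple sign) (c0 : 'I_k) (w : word k) n x :
    0 < x -> x < n ->
  let d := prefix_from (factor w 1 n.-1) x in
  (lt_sigma sigma (tail w n) (tail w x) <->
     lt_sigma sigma (tail w n) (periodic c0 d)) /\
  (lt_sigma sigma (tail w x) (tail w n) <->
     lt_sigma sigma (periodic c0 d) (tail w n)).
Proof.
move=> x_gt0 lt_xn d.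
have size_d : size d = n.-1 - x.-1 by rewrite size_drop size_factor.
apply: lt_periodic => [|m|m]; rewrite size_d.
- lia.
- by move=> lt_m; rewrite nth_drop nth_factor ?tailE //; lia.
- by rewrite !tailE; congr (w _); lia.
Qed.

(** * Greedy words are extremal *)

Lemma flips_all_plus k (sigma : k.-tuple sign) (v : word k) j :
  (forall i, v i \notin Tminus sigma) -> flips sigma v j = 0.
Proof. by move=> plus; rewrite /flips big_pred0 // => i; apply/negbTE. Qed.

Lemma flips_all_minus k (sigma : k.-tuple sign) (v : word k) j :
  (forall i, v i \in Tminus sigma) -> flips sigma v j = j.
Proof.
move=> minus; rewrite /flips (eq_bigl xpredT) => [|i]; last exact: minus.
by rewrite sum1_card card_ord.
Qed.

(** Once an odd number of negative letters has been read, smaller words are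
    those with the larger next letter; a word that always takes the best letter
    is thus a lower bound of all words. *)
Lemma greedy_smallest k (sigma : k.-tuple sign) (u v : word k) :
    (forall j, v j = (if odd (flips sigma v j) then k.-1 else 0) :> nat) ->
  ~ lt_sigma sigma u v.
Proof.
move=> greedy [d [eq_uv]]; rewrite (eq_flips sigma eq_uv) (greedy d).
by have := ltn_ord (u d); case: odd; lia.
Qed.

Lemma greedy_largest k (sigma : k.-tuple sign) (u v : word k) :
    (forall j, v j = (if odd (flips sigma v j) then 0 else k.-1) :> nat) ->
  ~ lt_sigma sigma v u.
Proof.
move=> greedy [d [eq_uv]]; rewrite (greedy d).
by have := ltn_ord (u d); case: odd; lia.
Qed.

Lemma periodic_factorE k (c0 : 'I_k) (w : word k) n x m : 0 < x < n ->
  periodic c0 (prefix_from (factor w 1 n.-1) x) m = w (x.-1 + m %% (n - x)).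
Proof.
move=> rx; have size_d : size (drop x.-1 (factor w 1 n.-1)) = n - x.
  by rewrite size_drop size_factor; lia.
rewrite /periodic /prefix_from size_d.
have : m %% (n - x) < n - x by rewrite ltn_pmod //; lia.
by move=> lt_r; rewrite nth_drop nth_factor //; lia.
Qed.

(** The word v is d^oo for d = w_x ... w_{n-1}.  Since W_x = d W_n, an
    inequality W_n < W_x would put W_n below the smallest word. *)
Lemma no_smallest_cycle k (hk : 2 <= k) (sigma : k.-tuple sign) (w : word k) n
    x : 0 < x < n ->
  let v : word k := fun m => w (x.-1 + m %% (n - x)) in
  (forall j, v j = (if odd (flips sigma v j) then k.-1 else 0) :> nat) ->
  ~ lt_sigma sigma (tail w n) (tail w x).
Proof.
move=> rx v greedy lt_x; have /andP[x_gt0 lt_xn] := rx.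
have [[lt_p _] _] := lt_tail_periodic sigma (letter0 hk) w x_gt0 lt_xn.
apply: (greedy_smallest greedy); apply: lt_sigma_eqr (lt_p lt_x) => m.
exact: periodic_factorE.
Qed.

Lemma no_largest_cycle k (hk : 2 <= k) (sigma : k.-tuple sign) (w : word k) n
    x : 0 < x < n ->
  let v : word k := fun m => w (x.-1 + m %% (n - x)) in
  (forall j, v j = (if odd (flips sigma v j) then 0 else k.-1) :> nat) ->
  ~ lt_sigma sigma (tail w x) (tail w n).
Proof.
move=> rx v greedy lt_x; have /andP[x_gt0 lt_xn] := rx.
have [_ [lt_p _]] := lt_tail_periodic sigma (letter0 hk) w x_gt0 lt_xn.
apply: (greedy_largest greedy); apply: lt_sigma_eql (lt_p lt_x) => m.
exact: periodic_factorE.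
Qed.

(** * One-line notation *)

Lemma size_one_line n (pi : 'S_n) : size (one_line pi) = n.
Proof. by rewrite size_map size_enum_ord. Qed.

Lemma one_line_uniq n (pi : 'S_n) : uniq (one_line pi).
Proof. by rewrite map_inj_uniq ?enum_uniq // => i j [/val_inj/perm_inj]. Qed.

Lemma mem_one_line n (pi : 'S_n) v : (v \in one_line pi) = (0 < v <= n).
Proof.
apply/mapP/idP => [[i _ ->]|]; first exact: ltn_ord.
case: v => // v lt_vn; exists (pi^-1%g (Ordinal lt_vn)); first exact: mem_enum.
by rewrite permKV.
Qed.

Lemma entry_range n (pi : 'S_n) i : 0 < i <= n -> 0 < entry pi i <= n.
Proof.
case: i => // i lt_in.
by rewrite -(mem_one_line pi) /entry /= mem_nth ?size_one_line.
Qed.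

Lemma position_entry n (pi : 'S_n) i :
  0 < i <= n -> position pi (entry pi i) = i.
Proof.
case: i => // i lt_in.
by rewrite /position /entry /= index_uniq ?one_line_uniq ?size_one_line.
Qed.

Lemma entry_inj n (pi : 'S_n) i j : 0 < i <= n -> 0 < j <= n ->
  entry pi i = entry pi j -> i = j.
Proof.
move=> ri rj eq_ij.
by rewrite -(position_entry pi ri) eq_ij position_entry.
Qed.

Lemma entry_position n (pi : 'S_n) v :
  0 < v <= n -> entry pi (position pi v) = v.
Proof. by move=> rv; rewrite /entry /= nth_index ?mem_one_line. Qed.

Lemma position_range n (pi : 'S_n) v : 0 < v <= n -> 0 < position pi v <= n.
Proof.
by move=> rv; rewrite /position /= -{2}(size_one_line pi) index_mem mem_one_line.
Qed.

Lemma entry_lt_last n (pi : 'S_n) i : 0 < i < n -> entry pi i <> entry pi n.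
Proof.
move=> ri eq_in; suff : i = n by lia.
by apply: entry_inj eq_in; lia.
Qed.

Lemma entry_suffix n (pi : 'S_n) s i : suffix s (one_line pi) ->
  entry pi (n - size s + i).+1 = nth 0 s i.
Proof.
rewrite suffixE size_one_line => /eqP eq_s.
by rewrite -[in RHS]eq_s nth_drop.
Qed.

(** * Blocks of the marked cycle *)

(** Sortedness of the defined values of f on an interval, read on pairs of
    arguments instead of consecutive values. *)
Lemma sorted_pmap_iota (r : rel nat) (f : nat -> option nat) a l :
    transitive r ->
  sorted r (pmap f (iota a l)) <->
  (forall x y u v, a <= x -> x < y -> y < a + l ->
     f x = Some u -> f y = Some v -> r u v).
Proof.
move=> r_tr; rewrite sorted_pairwise //.
elim: l a => [|l IHl] a /=; first by split=> // _ x y u v; lia.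
have IH := IHl a.+1; rewrite addSnnS in IH.
case fa: (f a) => [u|] /=.
  split=> [/andP[/allP r_u /IH r_pw] x y u' v|r_pw].
    rewrite leq_eqVlt => /orP[/eqP <-|lt_ax] lt_xy lt_y; last exact: r_pw.
    rewrite fa => -[<-] fy; apply: r_u; rewrite mem_pmap; apply/mapP.
    by exists y; rewrite ?mem_iota; [lia|].
  apply/andP; split; last by apply/IH => x y u' v /ltnW; apply: r_pw.
  apply/allP=> v; rewrite mem_pmap => /mapP[y]; rewrite mem_iota => ry fy.
  by apply: (r_pw a y) => //; lia.
split=> [/IH r_pw x y u v|r_pw]; last first.
  by apply/IH => x y u' v /ltnW; apply: r_pw.
by rewrite leq_eqVlt => /orP[/eqP <-|]; [rewrite fa | apply: r_pw].
Qed.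

Definition directed (s : sign) : rel nat := if s is Plus then ltn else gtn.

Lemma block_directed n (pi : 'S_n) s a b : a <= b -> b <= n ->
  is_true (if s is Plus then sorted ltn (block pi a b)
           else sorted gtn (block pi a b)) <->
  (forall i j, 0 < i < n -> 0 < j < n ->
     a < entry pi i -> entry pi i < entry pi j -> entry pi j <= b ->
     directed s (entry pi i.+1) (entry pi j.+1)).
Proof.
move=> le_ab le_bn.
have dir_tr : transitive (directed s).
  by case: s => x y z /= lt1 lt2; [apply: ltn_trans lt2 | apply: ltn_trans lt1].
have -> : (if s is Plus then sorted ltn (block pi a b)
           else sorted gtn (block pi a b)) = sorted (directed s) (block pi a b).
  by case: s {dir_tr}.
rewrite (sorted_pmap_iota _ _ _ dir_tr); split=> sorted_b.
  move=> i j /andP[i_gt0 lt_in] /andP[j_gt0 lt_jn] lt_ai lt_ij le_jb.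
  by apply: (sorted_b _ _ _ _ lt_ai lt_ij); rewrite ?marked_entry //; lia.
move=> x y u v lt_ax lt_xy lt_y.
have rx : 0 < x <= n by lia.
have ry : 0 < y <= n by lia.
rewrite /marked; have /andP[x_gt0 _] := position_range pi rx.
have /andP[y_gt0 _] := position_range pi ry.
case: ifP => // x_lt [<-]; case: ifP => // y_lt [<-].
by apply: sorted_b; rewrite ?entry_position ?x_gt0 ?y_gt0 //; lia.
Qed.

(** What a sigma-segmentation with prefix w_1 ... w_{n-1} says about w and pi,
    expressed without the cuts: one step of the recursive comparison of two
    tails is consistent with pi. *)
Definition order_compatible k (sigma : k.-tuple sign) (w : word k) n
    (pi : 'S_n) : Prop :=
  forall i j, 0 < i < n -> 0 < j < n -> entry pi i < entry pi j ->
  w i.-1 <= w j.-1 /\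
  (w i.-1 = w j.-1 ->
     directed (sgn sigma (w i.-1)) (entry pi i.+1) (entry pi j.+1)).

(** * From a segmentation to the pattern *)

Lemma cut_homo k (sigma : k.-tuple sign) n (pi : 'S_n) E :
  is_segmentation sigma pi E ->
  forall s t, s <= t -> t <= k -> cut E s <= cut E t.
Proof.
move=> segE s; elim=> [|t IHt]; first by rewrite leqn0 => /eqP->.
rewrite leq_eqVlt => /orP[/eqP-> //|le_st] lt_tk.
by apply: leq_trans (seg_mono segE lt_tk); apply: IHt; rewrite // ltnW.
Qed.

(** The cuts bracket every entry of pi, so the prefix condition determines each
    of the first n - 1 letters. *)
Lemma segmentation_letter k (sigma : k.-tuple sign) n (pi : 'S_n) E
    (w : word k) i :
    is_segmentation sigma pi E -> is_prefix_of pi E (factor w 1 n.-1) ->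
    0 < i < n ->
  cut E (w i.-1) < entry pi i <= cut E (w i.-1).+1.
Proof.
move=> segE [_ prefE] ri.
have /andP[e_gt0 e_le] : 0 < entry pi i <= n by apply: entry_range; lia.
have ex_t : exists t, entry pi i <= cut E t.
  by exists k; rewrite (seg_last segE).
(* The smallest cut that reaches the entry closes its block. *)
case: (ex_minnP ex_t) => -[|t]; first by rewrite (seg_first segE); lia.
move=> le_t min_t.
have lt_tk : t < k by apply: min_t; rewrite (seg_last segE).
have lt_t : cut E t < entry pi i.
  by rewrite ltnNge; apply/negP => /min_t; rewrite ltnn.
have z_i : onth (factor w 1 n.-1) i.-1 = Some (Ordinal lt_tk).
  by apply: prefE; rewrite /= ?lt_t //; lia.
have := onth_nth (Ordinal lt_tk) _ _ _ z_i; rewrite nth_factor; last lia.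
by move=> ->; rewrite lt_t.
Qed.

Lemma segmentation_compatible k (sigma : k.-tuple sign) n (pi : 'S_n) E
    (w : word k) :
    is_segmentation sigma pi E -> is_prefix_of pi E (factor w 1 n.-1) ->
  order_compatible sigma w pi.
Proof.
move=> segE prefE i j ri rj lt_ij.
have /andP[lt_i le_i] := segmentation_letter segE prefE ri.
have /andP[lt_j le_j] := segmentation_letter segE prefE rj.
split=> [|eq_w].
  rewrite leqNgt; apply/negP => lt_w.
  have := cut_homo segE lt_w (ltnW (ltn_ord _)); lia.
have lt_wk := ltn_ord (w i.-1).
have le_wn : cut E (w i.-1).+1 <= n.
  by rewrite -(seg_last segE); apply: (cut_homo segE).
have dir_w := proj1 (block_directed _ _ (seg_mono segE lt_wk) le_wn)
  (seg_a segE lt_wk).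
by apply: dir_w => //; rewrite eq_w.
Qed.

(** The condition W_y < W_n < W_x, without the half for which pi_n has no
    neighbour. *)
Definition adjacent_bounds k (sigma : k.-tuple sign) (w : word k) n
    (pi : 'S_n) : Prop :=
  (entry pi n <> n -> let x := position pi (entry pi n).+1 in
     lt_sigma sigma (tail w n) (tail w x)) /\
  (entry pi n <> 1 -> let y := position pi (entry pi n).-1 in
     lt_sigma sigma (tail w y) (tail w n)).

Lemma successor_position n (pi : 'S_n) : 0 < n -> entry pi n <> n ->
  let x := position pi (entry pi n).+1 in
  0 < x < n /\ entry pi x = (entry pi n).+1.
Proof.
move=> n_gt0 neq_n x.
have /andP[e_gt0 e_le] : 0 < entry pi n <= n by apply: entry_range; lia.
have r : 0 < (entry pi n).+1 <= n by lia.
have e_x := entry_position pi r; split=> //.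
have := position_range pi r; rewrite -/x => rx.
suff : x <> n by lia.
by move=> eq_xn; move: e_x; rewrite -/x eq_xn; lia.
Qed.

Lemma predecessor_position n (pi : 'S_n) : 0 < n -> entry pi n <> 1 ->
  let y := position pi (entry pi n).-1 in
  0 < y < n /\ (entry pi y).+1 = entry pi n.
Proof.
move=> n_gt0 neq_n y.
have /andP[e_gt0 e_le] : 0 < entry pi n <= n by apply: entry_range; lia.
have r : 0 < (entry pi n).-1 <= n by lia.
have e_y := entry_position pi r; rewrite -/y in e_y.
have := position_range pi r; rewrite -/y => ry.
suff : y <> n by lia.
by move=> eq_yn; move: e_y; rewrite eq_yn; lia.
Qed.

(** Strong induction on the depth of the inversion.  An inversion that involves
    n is first moved, without increasing its depth, to one between positions
    below n, by replacing n with the neighbour x or y; then the common first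
    letter is deleted. *)
Lemma no_inversion k (sigma : k.-tuple sign) (w : word k) n (pi : 'S_n) :
    0 < n -> order_compatible sigma w pi -> adjacent_bounds sigma w pi ->
  forall d i j, 0 < i <= n -> 0 < j <= n -> entry pi i < entry pi j ->
  ~ lt_at sigma d (tail w j) (tail w i).
Proof.
move=> n_gt0 compat [bound_x bound_y].
elim/ltn_ind=> d IHd.
have inner e i j : e <= d -> 0 < i < n -> 0 < j < n ->
    entry pi i < entry pi j -> ~ lt_at sigma e (tail w j) (tail w i).
  move=> le_ed ri rj lt_ij inv.
  have [le_w dir_w] := compat i j ri rj lt_ij.
  have := lt_at_head inv; rewrite !tail0 => ge_w.
  have eq_w : w j.-1 = w i.-1 by apply/val_inj/eqP; rewrite eqn_leq le_w ge_w.
  have := dir_w (esym eq_w).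
  have [] := lt_at_shift _ inv; rewrite ?tail0 //.
  rewrite -!tailS; [|lia|lia].
  rewrite eq_w in_Tminus; case: (sgn _ _) => e_gt0 inv' /= lt'.
    by apply: (IHd e.-1 _ i.+1 j.+1 _ _ _ inv') => //; lia.
  by apply: (IHd e.-1 _ j.+1 i.+1 _ _ _ inv') => //; lia.
move=> i j ri rj lt_ij inv.
have re : 0 < entry pi n <= n by apply: entry_range; lia.
have rei := entry_range pi ri.
have rej := entry_range pi rj.
case: (eqVneq i n) => [eq_in|neq_in].
  rewrite eq_in in inv lt_ij.
  have [|rx e_x] := @successor_position _ pi n_gt0; first lia.
  have [|f lt_x] := bound_x; first lia.
  have inv' := lt_at_trans inv lt_x.
  case: (eqVneq j (position pi (entry pi n).+1)) => [eq_j|neq_j].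
    by rewrite eq_j in inv'; apply: (lt_at_irr inv').
  apply: (inner _ _ _ _ rx _ _ inv'); first lia.
    by suff : j <> n by [lia]; move=> eq_jn; move: lt_ij; rewrite eq_jn; lia.
  suff : entry pi j <> (entry pi n).+1 by lia.
  by rewrite -e_x => /entry_inj eq_j; case/eqP: neq_j; apply: eq_j; lia.
case: (eqVneq j n) => [eq_jn|neq_jn]; last by apply: (inner d i j) => //; lia.
rewrite eq_jn in inv lt_ij.
have [|ry e_y] := @predecessor_position _ pi n_gt0; first lia.
have [|f lt_y] := bound_y; first lia.
have inv' := lt_at_trans lt_y inv.
case: (eqVneq i (position pi (entry pi n).-1)) => [eq_i|neq_i].
  by rewrite eq_i in inv'; apply: (lt_at_irr inv').
apply: (inner _ _ _ _ _ ry _ inv'); [lia|lia|].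
suff : (entry pi i).+1 <> entry pi n by lia.
by rewrite -e_y => -[/entry_inj eq_i]; case/eqP: neq_i; apply: eq_i; lia.
Qed.

(** It remains to exclude equal tails.  If W_i = W_j with i < j, shifting by
    n - j gives i' < n with W_{i'} = W_n; then W_{i'} is on the same side of W_x
    and W_y as W_n, while pi_{i'} is beyond one of the two neighbours of pi_n. *)
Lemma compatible_pattern k (sigma : k.-tuple sign) (w : word k) n (pi : 'S_n) :
    0 < n -> order_compatible sigma w pi -> adjacent_bounds sigma w pi ->
  has_pattern sigma w pi.
Proof.
move=> n_gt0 compat bounds.
have no_inv := no_inversion n_gt0 compat bounds.
have neq_tail i j : 1 <= i -> i < j -> j <= n -> ~ (tail w i =1 tail w j).
  move=> i_gt0 lt_ij le_jn eq_ij.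
  have [i' [ri' eq_i']] : exists i', 0 < i' < n /\ tail w i' =1 tail w n.
    exists (i + (n - j)); split=> [|m]; first lia.
    have := eq_ij (n - j + m); rewrite !tailE.
    by congr (w _ = w _); lia.
  have := entry_lt_last ri' (pi := pi); case: bounds => bound_x bound_y neq_e.
  have re : 0 < entry pi n <= n by apply: entry_range; lia.
  have re' : 0 < entry pi i' <= n by apply: entry_range; lia.
  case: (ltngtP (entry pi i') (entry pi n)) => // lt_e.
    have neq1 : entry pi n <> 1 by lia.
    have [ry e_y] := predecessor_position n_gt0 neq1.
    have [d lt_y] := lt_sigma_eqr (fsym eq_i') (bound_y neq1).
    case: (eqVneq i' (position pi (entry pi n).-1)) => [eq_y|neq_y].
      by rewrite -eq_y in lt_y; apply: lt_at_irr lt_y.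
    apply: (no_inv d i' _ _ _ _ lt_y); [lia|lia|].
    suff : (entry pi i').+1 <> entry pi n by lia.
    by rewrite -e_y => -[/entry_inj eq_y]; case/eqP: neq_y; apply: eq_y; lia.
  have neqn : entry pi n <> n by lia.
  have [rx e_x] := successor_position n_gt0 neqn.
  have [d lt_x] := lt_sigma_eql (fsym eq_i') (bound_x neqn).
  case: (eqVneq i' (position pi (entry pi n).+1)) => [eq_x|neq_x].
    by rewrite -eq_x in lt_x; apply: lt_at_irr lt_x.
  apply: (no_inv d _ i' _ _ _ lt_x); [lia|lia|].
  suff : entry pi i' <> (entry pi n).+1 by lia.
  by rewrite -e_x => /entry_inj eq_x; case/eqP: neq_x; apply: eq_x; lia.
have lt_tails i j : 1 <= i <= n -> 1 <= j <= n -> entry pi i < entry pi j ->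
    lt_sigma sigma (tail w i) (tail w j).
  move=> ri rj lt_ij.
  case: (lt_sigma_total sigma (tail w i) (tail w j)) => // [eq_ij|[d inv]].
    have [lt|lt|eq] := ltngtP i j.
    - by case: (neq_tail i j) => //; lia.
    - by case: (neq_tail j i) => //; lia.
    - by rewrite eq ltnn in lt_ij.
  by case: (no_inv d i j).
split=> // i j ri rj; split=> [|lt_ij]; first exact: lt_tails.
have [//|lt_ji|/entry_inj eq_ij] := ltngtP (entry pi i) (entry pi j).
  by case: (lt_sigma_asym lt_ij); apply: lt_tails.
by move: lt_ij; rewrite eq_ij // => -[d /lt_at_irr].
Qed.

(** * From the pattern to a segmentation *)

Lemma pattern_compatible k (sigma : k.-tuple sign) (w : word k) n (pi : 'S_n) :
  has_pattern sigma w pi -> order_compatible sigma w pi.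
Proof.
move=> [_ pat] i j ri rj lt_ij.
have lt_w : lt_sigma sigma (tail w i) (tail w j) by apply/pat => //; lia.
split=> [|eq_w].
  by case: lt_w => d /lt_at_head; rewrite !tail0.
have := lt_sigma_shift _ lt_w; rewrite !tail0 -!tailS; [|lia|lia].
move=> /(_ eq_w); rewrite in_Tminus.
by case: (sgn _ _) => /= lt_w'; apply/pat => //; lia.
Qed.

Lemma pattern_bounds k (sigma : k.-tuple sign) (w : word k) n (pi : 'S_n) :
  0 < n -> has_pattern sigma w pi -> adjacent_bounds sigma w pi.
Proof.
move=> n_gt0 [_ pat]; split=> [/(successor_position n_gt0)|
  /(predecessor_position n_gt0)] [rx e_x] x; apply/pat; rewrite -/x in rx e_x; lia.
Qed.

(** Taking the largest entry rather than the number of tails with a letter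
    below t leaves out the last position n, so that the cut never falls on
    pi_n.  The last cut has to be n even when pi_n = n. *)
Definition max_cut k (w : word k) n (pi : 'S_n) (t : nat) : nat :=
  if t == k then n else \max_(i < n.-1 | w i < t) entry pi i.+1.

(** If pi_i is at most the entry pi_l of a position with w_l < t, then
    compatibility gives w_i <= w_l < t. *)
Lemma max_cut_letter k (sigma : k.-tuple sign) (w : word k) n (pi : 'S_n) t i :
    order_compatible sigma w pi -> t <= k -> 0 < i < n ->
  (entry pi i <= max_cut w pi t) = (w i.-1 < t).
Proof.
move=> compat le_tk ri; rewrite /max_cut; case: eqP => [->|_].
  by rewrite ltn_ord; have := @entry_range n pi i; lia.
have e_gt0 : 0 < entry pi i by have := @entry_range n pi i; lia.
have lt_i : i.-1 < n.-1 by lia.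
apply/idP/idP; last first.
  move=> lt_w; have := @leq_bigmax_cond _ (fun l : 'I_n.-1 => w l < t)
    (fun l => entry pi l.+1) (Ordinal lt_i) lt_w.
  by rewrite /= prednK //; lia.
apply: contraLR; rewrite -leqNgt -ltnNge => le_tw.
rewrite -(prednK e_gt0) ltnS; apply/bigmax_leqP => l lt_lt.
have lt_l := ltn_ord l; rewrite -ltnS (prednK e_gt0) ltnNge leq_eqVlt.
apply/negP => /orP[/eqP /entry_inj eq_il|lt_il].
  have eq_i : i = l.+1 by apply: eq_il; lia.
  by move: le_tw; rewrite eq_i /= leqNgt lt_lt.
have [|//|/= le_w _] := compat i l.+1 _ _ lt_il; lia.
Qed.

Lemma max_cut_le k (w : word k) n (pi : 'S_n) t : max_cut w pi t <= n.
Proof.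
rewrite /max_cut; case: eqP => // _; apply/bigmax_leqP => l _.
by have := @entry_range n pi l.+1; have := ltn_ord l; lia.
Qed.

Lemma max_cut_mono k (w : word k) n (pi : 'S_n) t :
  t < k -> max_cut w pi t <= max_cut w pi t.+1.
Proof.
move=> lt_tk; rewrite {2}/max_cut; case: eqP => [_|_]; first exact: max_cut_le.
rewrite /max_cut; case: eqP => [|_]; first lia.
by apply/bigmax_leqP => l lt_l; apply: leq_bigmax_cond; apply: ltnW.
Qed.

Lemma max_cut_neq_last k (w : word k) n (pi : 'S_n) t :
  0 < n -> t < k -> max_cut w pi t <> entry pi n.
Proof.
move=> n_gt0 lt_tk; rewrite /max_cut; case: eqP => [|_]; first lia.
have := @entry_range n pi n.
elim/big_ind: _ => [|a b neq_a neq_b|l _] re; first lia.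
  by rewrite maxnE; lia.
by apply: entry_lt_last; have := ltn_ord l; lia.
Qed.

Lemma max_cut1_eq0 k (sigma : k.-tuple sign) (w : word k) n (pi : 'S_n) i :
    2 <= k -> order_compatible sigma w pi -> 0 < i < n ->
    (forall j, 0 < j < n -> entry pi i <= entry pi j) -> 0 < w i.-1 ->
  max_cut w pi 1 = 0.
Proof.
move=> hk compat ri min_i w_gt0; apply/eqP; rewrite -leqn0 /max_cut.
case: eqP => [|_]; first lia.
apply/bigmax_leqP => l lt_l; have lt_ln := ltn_ord l.
have : entry pi i <= entry pi l.+1 by apply: min_i; lia.
rewrite leq_eqVlt => /orP[/eqP/entry_inj eq_il|lt_il].
- have eq_i : i = l.+1 by apply: eq_il; lia.
  by move: w_gt0; rewrite eq_i /=; lia.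
- by have [|//|/= le_w _] := compat i l.+1 _ _ lt_il; lia.
Qed.

(** For each condition on the last entries of pi, the extreme positions tell
    whether the letters 0 and k - 1 occur before position n.  If they do occur
    where the condition forbids it, the last one or two letters before position
    n are these, and they form a cycle that is a greedy word. *)
Lemma pattern_segmentation k (hk : 2 <= k) (sigma : k.-tuple sign) n
    (hn : 2 <= n) (pi : 'S_n) (w : word k) (E : k.+1.-tuple nat) :
    has_pattern sigma w pi ->
    (forall t, t <= k -> cut E t = max_cut w pi t) ->
  is_segmentation sigma pi E.
Proof.
move=> pat cutE; have compat := pattern_compatible pat.
have letter t i := @max_cut_letter _ _ _ _ _ t i compat.
have n_gt0 : 0 < n by lia.
have lt_pat i j : 0 < i <= n -> 0 < j <= n -> entry pi i < entry pi j ->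
    lt_sigma sigma (tail w i) (tail w j).
  by move=> ri rj; case: pat => _ /(_ i j ri rj)[].
have range i : 0 < i <= n -> 0 < entry pi i <= n by apply: entry_range.
(* The position i carries the smallest entry other than pi_n. *)
have e1_0 i : 0 < i < n -> w i.-1 != 0 :> nat -> entry pi i <= 2 ->
    (entry pi i = 2 -> entry pi n = 1) -> cut E 1 = 0.
  move=> ri w_neq0 le2 eq2; rewrite cutE; last lia.
  apply: (max_cut1_eq0 hk compat ri); last by rewrite lt0n.
  move=> j rj; have := range j; have := @entry_lt_last _ pi j rj; lia.
have ek_ge i : 0 < i < n -> w i.-1 != k.-1 :> nat -> entry pi i <= cut E k.-1.
  move=> ri w_neq; rewrite cutE; last lia.
  by rewrite letter //; [have := ltn_ord (w i.-1); lia | lia].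
have ek_le : cut E k.-1 <= n by rewrite cutE ?max_cut_le; lia.
have ek_neq : cut E k.-1 <> entry pi n.
  by rewrite cutE; [apply: max_cut_neq_last; lia | lia].
have size_suf s : suffix s (one_line pi) -> size s <= n.
  by move=> /size_suffix; rewrite size_one_line.
split.
- rewrite cutE // /max_cut; case: eqP => [|_]; first lia.
  by rewrite big_pred0.
- by move=> t lt_tk; rewrite !cutE ?max_cut_mono // ltnW.
- by rewrite cutE // /max_cut eqxx.
- move=> t lt_tk; apply/block_directed.
  + by rewrite !cutE ?max_cut_mono // ltnW.
  + by rewrite cutE // max_cut_le.
  move=> i j ri rj lt_i lt_ij le_j.
  rewrite !cutE // ?(ltnW lt_tk) // in lt_i le_j.
  have letter_t l : 0 < l < n -> max_cut w pi t < entry pi l ->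
      entry pi l <= max_cut w pi t.+1 -> w l.-1 = t :> nat.
    by move=> rl; rewrite ltnNge !letter //; lia.
  have w_i : w i.-1 = t :> nat by apply: letter_t => //; lia.
  have w_j : w j.-1 = t :> nat by apply: letter_t => //; lia.
  have [_ dir_w] := compat i j ri rj lt_ij.
  by rewrite w_i in dir_w; apply: dir_w; apply: val_inj; rewrite /= w_i w_j.
(* pi ends with 2 1: otherwise W_n < 0 W_n, with 0^oo the smallest word. *)
- move=> s0 suf; have n2 := size_suf _ suf.
  have en1 := entry_suffix 0 suf; have en := entry_suffix 1 suf.
  rewrite /= in n2 en1 en.
  have in1 : (n - 2 + 0).+1 = n.-1 by lia.
  have in0 : (n - 2 + 1).+1 = n by lia.
  rewrite in1 in en1; rewrite in0 in en.
  apply: (e1_0 n.-1) => //; [lia| |lia].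
  apply/negP => /eqP w0.
  apply: (@no_smallest_cycle _ hk sigma w n n.-1); first lia; last first.
    by apply: lt_pat; lia.
  have -> : n - n.-1 = 1 by lia.
  move=> j; rewrite flips_all_plus => [|i] /=; rewrite modn1 addn0 //.
  by rewrite in_Tminus w0 s0.
(* pi ends with n-1, n: otherwise (k-1) W_n < W_n, with (k-1)^oo the largest
   word. *)
- move=> sk suf; have n2 := size_suf _ suf.
  have en1 := entry_suffix 0 suf; have en := entry_suffix 1 suf.
  rewrite /= in n2 en1 en.
  have in1 : (n - 2 + 0).+1 = n.-1 by lia.
  have in0 : (n - 2 + 1).+1 = n by lia.
  rewrite in1 in en1; rewrite in0 in en.
  have := ek_ge n.-1; rewrite en1.
  case: (eqVneq (w n.-1.-1 : nat) k.-1) => [wk _|_ h]; last first.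
    by have := h _ isT; lia.
  case: (@no_largest_cycle _ hk sigma w n n.-1); first lia; last first.
    by apply: lt_pat; lia.
  have -> : n - n.-1 = 1 by lia.
  move=> j; rewrite flips_all_plus => [|i] /=; rewrite modn1 addn0 //.
  by rewrite in_Tminus wk sk.
(* pi ends with n-1, 1, n: otherwise (k-1) 0 W_n < W_n. *)
- move=> s0 sk suf; have n3 := size_suf _ suf.
  have en2 := entry_suffix 0 suf; have en1 := entry_suffix 1 suf.
  have en := entry_suffix 2 suf; rewrite /= in n3 en2 en1 en.
  have in2 : (n - 3 + 0).+1 = n.-2 by lia.
  have in1 : (n - 3 + 1).+1 = n.-1 by lia.
  have in0 : (n - 3 + 2).+1 = n by lia.
  rewrite in2 in en2; rewrite in1 in en1; rewrite in0 in en.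
  case: (eqVneq (w n.-1.-1 : nat) 0) => [w0|neq0]; last first.
    by left; apply: (e1_0 n.-1) => //; lia.
  case: (eqVneq (w n.-2.-1 : nat) k.-1) => [wk|neqk]; last first.
    by right; have := ek_ge n.-2; rewrite en2 => /(_ _ neqk); lia.
  case: (@no_largest_cycle _ hk sigma w n n.-2); first lia; last first.
    by apply: lt_pat; lia.
  have -> : n - n.-2 = 2 by lia.
  have v_j j : w (n.-2.-1 + j %% 2) = (if odd j then 0 else k.-1) :> nat.
    rewrite modn2; case: odd; last by rewrite addn0.
    by rewrite -w0; congr (nat_of_ord (w _)); lia.
  move=> j; rewrite flips_all_minus; first exact: v_j.
  by move=> i; rewrite in_Tminus v_j; case: odd; rewrite ?s0 ?sk.
(* pi ends with 2, n, 1: otherwise W_n < 0 (k-1) W_n. *)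
- move=> s0 sk suf; have n3 := size_suf _ suf.
  have en2 := entry_suffix 0 suf; have en1 := entry_suffix 1 suf.
  have en := entry_suffix 2 suf; rewrite /= in n3 en2 en1 en.
  have in2 : (n - 3 + 0).+1 = n.-2 by lia.
  have in1 : (n - 3 + 1).+1 = n.-1 by lia.
  have in0 : (n - 3 + 2).+1 = n by lia.
  rewrite in2 in en2; rewrite in1 in en1; rewrite in0 in en.
  case: (eqVneq (w n.-2.-1 : nat) 0) => [w0|neq0]; last first.
    by left; apply: (e1_0 n.-2) => //; lia.
  case: (eqVneq (w n.-1.-1 : nat) k.-1) => [wk|neqk]; last first.
    by right; have := ek_ge n.-1; rewrite en1 => /(_ _ neqk); lia.
  case: (@no_smallest_cycle _ hk sigma w n n.-2); first lia; last first.
    by apply: lt_pat; lia.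
  have -> : n - n.-2 = 2 by lia.
  have v_j j : w (n.-2.-1 + j %% 2) = (if odd j then k.-1 else 0) :> nat.
    rewrite modn2; case: odd; last by rewrite addn0.
    by rewrite -wk; congr (nat_of_ord (w _)); lia.
  move=> j; rewrite flips_all_minus; first exact: v_j.
  by move=> i; rewrite in_Tminus v_j; case: odd; rewrite ?s0 ?sk.
- by move=> t rt; rewrite cutE; [apply: max_cut_neq_last; lia | lia].
Qed.

Lemma pattern_prefix k (sigma : k.-tuple sign) n (pi : 'S_n) (w : word k)
    (E : k.+1.-tuple nat) :
    has_pattern sigma w pi ->
    (forall t, t <= k -> cut E t = max_cut w pi t) ->
  is_prefix_of pi E (factor w 1 n.-1).
Proof.
move=> pat cutE; split=> [|i j ri]; first exact: size_factor.
have compat := pattern_compatible pat; have lt_jk := ltn_ord j.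
have ri' : 0 < i < n by lia.
rewrite (cutE _ (ltnW lt_jk)) (cutE _ lt_jk) ltnNge.
rewrite (max_cut_letter compat (ltnW lt_jk) ri').
rewrite (max_cut_letter compat lt_jk ri').
move=> w_i; have -> : j = w i.-1 by apply: val_inj => /=; lia.
rewrite onthE (nth_map (w 0)) ?size_factor; last lia.
by rewrite nth_factor //; lia.
Qed.

(** * The periodic bounds and the equivalence *)

(** The words W_x and W_y are p W_n and q W_n. *)
Lemma bounds_periodic k (sigma : k.-tuple sign) (c0 : 'I_k) (w : word k) n
    (pi : 'S_n) :
    0 < n -> let zeta := factor w 1 n.-1 in
  adjacent_bounds sigma w pi <->
  (entry pi n <> n ->
     lt_sigma sigma (tail w n) (periodic c0 (word_p pi zeta))) /\
  (entry pi n <> 1 ->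
     lt_sigma sigma (periodic c0 (word_q pi zeta)) (tail w n)).
Proof.
move=> n_gt0 zeta; split=> -[bound_p bound_q]; split=> neq.
- have [/andP[x_gt0 lt_xn] _] := successor_position n_gt0 neq.
  have [iff_p _] := lt_tail_periodic sigma c0 w x_gt0 lt_xn.
  by apply/iff_p; apply: bound_p.
- have [/andP[y_gt0 lt_yn] _] := predecessor_position n_gt0 neq.
  have [_ iff_q] := lt_tail_periodic sigma c0 w y_gt0 lt_yn.
  by apply/iff_q; apply: bound_q.
- have [/andP[x_gt0 lt_xn] _] := successor_position n_gt0 neq.
  have [iff_p _] := lt_tail_periodic sigma c0 w x_gt0 lt_xn.
  by apply/iff_p; apply: bound_p.
- have [/andP[y_gt0 lt_yn] _] := predecessor_position n_gt0 neq.
  have [_ iff_q] := lt_tail_periodic sigma c0 w y_gt0 lt_yn.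
  by apply/iff_q; apply: bound_q.
Qed.

(** If one of p and q is the square of the other, then p^oo = q^oo and no word
    lies strictly between them. *)
Lemma between_periodic_valid k (sigma : k.-tuple sign) (c0 : 'I_k)
    (u : word k) n (pi : 'S_n) zeta :
    (entry pi n <> n -> lt_sigma sigma u (periodic c0 (word_p pi zeta))) ->
    (entry pi n <> 1 -> lt_sigma sigma (periodic c0 (word_q pi zeta)) u) ->
  ~ invalid pi zeta.
Proof.
move=> lt_p lt_q [neq1 neqn pq].
have eq_pq : periodic c0 (word_p pi zeta) =1 periodic c0 (word_q pi zeta).
  by move=> m; case: pq => ->; rewrite periodic_double.
apply: (lt_sigma_asym (lt_q neq1)).
exact: lt_sigma_eqr eq_pq (lt_p neqn).
Qed.

Theorem theorem4p4 (k : nat) (hk : 2 <= k) (sigma : k.-tuple sign)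
    (n : nat) (hn : 2 <= n) (pi : 'S_n) (w : word k) :
  has_pattern sigma w pi <->
  exists (E : k.+1.-tuple nat) (zeta : seq 'I_k),
    valid_segmentation sigma pi E zeta /\
    zeta = factor w 1 n.-1 /\
    let p_inf := periodic (letter0 hk) (word_p pi zeta) in
    let q_inf := periodic (letter0 hk) (word_q pi zeta) in
    [/\ entry pi n <> 1 -> entry pi n <> n ->
          lt_sigma sigma q_inf (tail w n) /\ lt_sigma sigma (tail w n) p_inf,
        entry pi n = 1 ->
          le_sigma sigma (omega_word hk sigma) (tail w n) /\
          lt_sigma sigma (tail w n) p_inf
      & entry pi n = n ->
          lt_sigma sigma q_inf (tail w n) /\
          le_sigma sigma (tail w n) (Omega_word hk sigma)].
Proof.
have n_gt0 : 0 < n by lia.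
split=> [pat|[E [zeta [[segE prefE _] [eq_zeta [mid low high]]]]]].
  have /(bounds_periodic _ (letter0 hk) _ _ n_gt0)[lt_p lt_q] :=
    pattern_bounds n_gt0 pat.
  have cutE t : t <= k ->
      cut [tuple of mkseq (max_cut w pi) k.+1] t = max_cut w pi t.
    by move=> le_tk; rewrite /cut nth_mkseq.
  exists [tuple of mkseq (max_cut w pi) k.+1], (factor w 1 n.-1).
  split; first split.
  - exact: (pattern_segmentation hk hn pat cutE).
  - exact: (pattern_prefix pat cutE).
  - exact: (between_periodic_valid lt_p lt_q).
  split=> // p_inf q_inf; split=> [neq1 neqn|eq1|eqn].
  - by split; [apply: lt_q | apply: lt_p].
  - split; first exact: (proj2_sig (smallest_word_exists hk sigma)).
    by apply: lt_p; lia.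
  - split; first by apply: lt_q; lia.
    exact: (proj2_sig (largest_word_exists hk sigma)).
rewrite {}eq_zeta in prefE mid low high.
apply: (compatible_pattern n_gt0 (segmentation_compatible segE prefE)).
apply/(bounds_periodic _ (letter0 hk) _ _ n_gt0); split=> neq.
  case: (eqVneq (entry pi n) 1) => [/low[] //|/eqP neq1].
  by case: (mid neq1 neq).
case: (eqVneq (entry pi n) n) => [/high[] //|/eqP neqn].
by case: (mid neq neqn).
Qed.
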